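(* Let $G$ be an $m\times n$ grid in which one side length is even and the other is odd. Every non-partitive initial configuration of $k\ge3$ robots on distinct nodes of $G$ is gatherable despite at most one crash fault.
   Context: Model. The grid is the anonymous grid graph. A configuration is a map $f:V(G)\to\{0,1,2\}$ ($0$ empty, $1$ singleton, $2$ multiplicity = at least two robots). Initially robots occupy distinct nodes. Robots are anonymous, identical, oblivious, cannot communicate, share no coordinate system, orientation or chirality, and run the same deterministic algorithm. Each robot repeatedly performs Look–Compute–Move cycles: it takes a snapshot of the whole configuration (global visibility, weak multiplicity detection: it learns $f$ up to grid symmetries), decides to stay or move to an adjacent node, and moves instantaneously. Fully asynchronous: every non-crashed robot is activated infinitely often, durations are finite, unbounded and adversarial, so moves may be based on outdated snapshots. At most one robot may crash at an adversarial time: it stops forever, stays visible and is indistinguishable. A configuration is gatherable despite at most one crash fault if some such algorithm guarantees, in every execution with at most one crash, that after finite time all non-crashed robots are on one node and remain there. Partitive: an automorphism of $(G,f)$ is a graph automorphism $\varphi$ with $f\circ\varphi=f$; the configuration is partitive if some automorphism $\varphi$ of order $p>1$ has all orbits of $V(G)$ under $\langle\varphi\rangle$ of size exactly $p$. *)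

(* Defs.v *)
From mathcomp Require Import all_boot all_fingroup.
Set Implicit Arguments. Unset Strict Implicit. Unset Printing Implicit Defensive.

Definition node (m n : nat) : finType := ('I_m * 'I_n)%type.

Definition adj (m n : nat) (u v : node m n) : bool :=
  ((val u.1 == val v.1) && (((val u.2).+1 == val v.2) || ((val v.2).+1 == val u.2)))
  || ((val u.2 == val v.2) && (((val u.1).+1 == val v.1) || ((val v.1).+1 == val u.1))).

Definition grid_aut (m n : nat) (phi : {perm node m n}) : Prop :=
  forall u v : node m n, adj u v = adj (phi u) (phi v).

(* Configurations f : V(G) -> {0,1,2} (weak multiplicity detection). *)
Definition config (m n : nat) := {ffun node m n -> nat}.

Definition conf_of (m n k : nat) (p : 'I_k -> node m n) : config m n :=
  [ffun v => minn 2 #|[set i | p i == v]|].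

Definition conf_aut (m n : nat) (f : config m n) (phi : {perm node m n}) : Prop :=
  grid_aut phi /\ forall v, f (phi v) = f v.

Definition partitive (m n : nat) (f : config m n) : Prop :=
  exists phi : {perm node m n},
    conf_aut f phi /\ 1 < #[phi]%g /\
    forall v : node m n, fingraph.order phi v = #[phi]%g.

(* An algorithm: given the snapshot (in the robot's local frame) and the
   robot's own position in that frame, returns the destination. *)
Definition algorithm (m n : nat) := config m n -> node m n -> node m n.

Definition valid_alg (m n : nat) (A : algorithm m n) : Prop :=
  forall f v, A f v = v \/ adj v (A f v).

(* Snapshot expressed in the local frame phi (global node w is seen as phi w). *)
Definition relabel (m n : nat) (phi : {perm node m n}) (f : config m n) : config m n :=
  [ffun w => f ((phi^-1)%g w)].

(* Destination computed from a Look at global configuration f by a robot at v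
   whose local frame for this cycle is phi. *)
Definition look (m n : nat) (A : algorithm m n) (phi : {perm node m n})
  (f : config m n) (v : node m n) : node m n :=
  (phi^-1)%g (A (relabel phi f) (phi v)).

Definition upd (I : eqType) (T : Type) (g : I -> T) (i : I) (x : T) : I -> T :=
  fun j => if j == i then x else g j.

(* State: positions, and pending destination (Some d after Look, before Move). *)
Record state (m n k : nat) := St { pos : 'I_k -> node m n ; pend : 'I_k -> option (node m n) }.

(* Asynchronous execution: at step t robot act t performs its next event
   (Look with frame phis t if idle, Move to its pending destination otherwise). *)
Fixpoint exec (m n k : nat) (A : algorithm m n) (p0 : 'I_k -> node m n)
  (act : nat -> 'I_k) (phis : nat -> {perm node m n}) (t : nat) : state m n k :=
  match t with
  | 0 => St p0 (fun _ => None)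
  | t'.+1 =>
      let s := exec A p0 act phis t' in
      let i := act t' in
      match pend s i with
      | None => St (pos s) (upd (pend s) i (Some (look A (phis t') (conf_of (pos s)) (pos s i))))
      | Some d => St (upd (pos s) i d) (upd (pend s) i None)
      end
  end.

(* At most one crash: crash = Some (c, tc) means robot c crashes at time tc. *)
Definition faulty (k : nat) (crash : option ('I_k * nat)) (i : 'I_k) : Prop :=
  exists tc, crash = Some (i, tc).

Definition crash_respected (k : nat) (crash : option ('I_k * nat)) (act : nat -> 'I_k) : Prop :=
  forall (i : 'I_k) tc t, crash = Some (i, tc) -> tc <= t -> act t <> i.

Definition fair (k : nat) (crash : option ('I_k * nat)) (act : nat -> 'I_k) : Prop :=
  forall i : 'I_k, ~ faulty crash i -> forall t, exists t', t <= t' /\ act t' = i.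

Definition gathered (m n k : nat) (crash : option ('I_k * nat)) (s : nat -> state m n k) : Prop :=
  exists (T : nat) (g : node m n), forall t, T <= t ->
    forall i : 'I_k, ~ faulty crash i -> pos (s t) i = g.

Definition gatherable_1crash (m n k : nat) (p0 : 'I_k -> node m n) : Prop :=
  exists A : algorithm m n, valid_alg A /\
    forall (act : nat -> 'I_k) (phis : nat -> {perm node m n}) (crash : option ('I_k * nat)),
      (forall t, grid_aut (phis t)) ->
      crash_respected crash act -> fair crash act ->
      gathered crash (exec A p0 act phis).

(* Main.v *)
Require Import Defs.
From Stdlib Require Import Classical_Prop.
From mathcomp Require Import all_boot all_fingroup cyclic.
From mathcomp Require Import zify.

Set Implicit Arguments. Unset Strict Implicit. Unset Printing Implicit Defensive.

(** Call the even side vertical.  The reflections that exchange the two halves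
    have no fixed point, so a non-partitive configuration can be oriented: one
    half is declared "upper", and the robots gather at the end [goal] of the
    middle column in that half.  Upper robots walk to [goal]; a lower robot
    climbs straight up whenever the node above it is free or upper, and
    unconditionally once [goal] is a multiplicity.

    The orientation is never lost.  Nobody enters the mirror image [antigoal] of
    [goal], and as long as [goal] is not a multiplicity the lower half contains
    none, because a node of the lower half is only entered from the node below
    it.  So any multiplicity reveals the upper half; without multiplicities, it
    is revealed by a potential that strictly increases with every move, is
    complemented by the mirror reflection and is initially at least balanced.
    If it is initially exactly balanced, the asymmetry of the initial
    configuration decides.

    The potential is bounded, so the execution becomes stationary.  Initially at
    least two robots are upper, hence if [goal] were not a multiplicity in the end,
    one of these two would have crashed away from [goal], and the topmost lower
    robot could still climb.  So [goal] is a multiplicity, and then only crashed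
    robots can be elsewhere. *)

(* [row] is the coordinate along the even side, of length [h + h], and [col] the one
   along the odd side, of length [(c + c).+1]; [cell] is unspecified out of bounds. *)
Record chart (m n h c : nat) := Chart {
  row : node m n -> nat;
  col : node m n -> nat;
  cell : nat -> nat -> node m n;
  row_lt : forall v, row v < h + h;
  col_le : forall v, col v <= c + c;
  row_cell : forall a b, a < h + h -> b <= c + c -> row (cell a b) = a;
  col_cell : forall a b, a < h + h -> b <= c + c -> col (cell a b) = b;
  rowcol_inj : forall u v, row u = row v -> col u = col v -> u = v;
  adjP : forall u v, adj u v <->
    (row u = row v /\ ((col u).+1 = col v \/ (col v).+1 = col u)) \/
    (col u = col v /\ ((row u).+1 = row v \/ (row v).+1 = row u)) }.

(** * Reflections of the grid and its automorphism group *)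

Section Reflections.

Variables (m n h c : nat) (X : chart m n h c).
Notation V := (node m n).
Notation row := (row X).
Notation col := (col X).
Notation cell := (cell X).

(** [a] switches on the mirror exchanging the two halves, [b] the one about the middle column. *)
Definition refl (a b : bool) (v : V) : V :=
  cell (if a then (h + h).-1 - row v else row v)
       (if b then c + c - col v else col v).

Lemma row_refl a b v : row (refl a b v) = if a then (h + h).-1 - row v else row v.
Proof.
have := row_lt X v; have := col_le X v; rewrite /refl => *.
by apply: row_cell; case: a; case: b; lia.
Qed.

Lemma col_refl a b v : col (refl a b v) = if b then c + c - col v else col v.
Proof.
have := row_lt X v; have := col_le X v; rewrite /refl => *.
by apply: col_cell; case: a; case: b; lia.
Qed.

Lemma refl_cell a b r l : r < h + h -> l <= c + c ->
  refl a b (cell r l) = cell (if a then (h + h).-1 - r else r) (if b then c + c - l else l).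
Proof. by move=> *; rewrite /refl row_cell // col_cell. Qed.

Lemma refl_comp a b a' b' v : refl a b (refl a' b' v) = refl (a (+) a') (b (+) b') v.
Proof.
have := row_lt X v; have := col_le X v => hc hr.
by apply: (@rowcol_inj _ _ _ _ X); rewrite ?row_refl ?col_refl;
  case: a; case: a'; case: b; case: b' => //=; lia.
Qed.

Lemma refl_id v : refl false false v = v.
Proof. by apply: (@rowcol_inj _ _ _ _ X); rewrite ?row_refl ?col_refl. Qed.

Lemma reflK a b : involutive (refl a b).
Proof. by move=> v; rewrite refl_comp !addbb refl_id. Qed.

Definition reflp a b : {perm V} := perm (inv_inj (reflK a b)).

Lemma reflpV a b : ((reflp a b)^-1)%g = reflp a b.
Proof.
by apply/permP=> v; apply: (perm_inj (s := reflp a b)); rewrite permKV !permE reflK.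
Qed.

Lemma adj_refl a b u v : adj u v -> adj (refl a b u) (refl a b v).
Proof.
move/(adjP X) => H; apply/(adjP X); rewrite !row_refl !col_refl.
have := row_lt X v; have := col_le X v; have := row_lt X u; have := col_le X u.
by case: a; case: b; lia.
Qed.

Lemma grid_aut_reflp a b : grid_aut (reflp a b).
Proof.
move=> u v; rewrite !permE; apply/idP/idP; first exact: adj_refl.
by move/(adj_refl a b); rewrite !reflK.
Qed.

(** The taxicab distance: each absolute difference is a sum of two truncated subtractions. *)
Definition dist (u v : V) :=
  (row u - row v) + (row v - row u) + ((col u - col v) + (col v - col u)).

Lemma dist_step u v s : dist u v = s.+1 -> exists w, adj u w /\ dist w v = s.
Proof.
rewrite /dist => H.
have Hu := row_lt X u; have Hu' := col_le X u.
have Hv := row_lt X v; have Hv' := col_le X v.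
suff [a [b [ha hb Ha Hs]]] : exists a b, [/\ a < h + h, b <= c + c,
   (row u = a /\ ((col u).+1 = b \/ b.+1 = col u)) \/
   (col u = b /\ ((row u).+1 = a \/ a.+1 = row u)) &
   (a - row v) + (row v - a) + ((b - col v) + (col v - b)) = s].
  by exists (cell a b); split; [apply/(adjP X)|]; rewrite row_cell ?col_cell.
case: (ltngtP (row u) (row v)) => Hr.
- by exists (row u).+1, (col u); split; lia.
- by exists (row u).-1, (col u); split; lia.
case: (ltngtP (col u) (col v)) => Hc.
- by exists (row u), (col u).+1; split; lia.
- by exists (row u), (col u).-1; split; lia.
lia.
Qed.

Lemma grid_aut_inv (phi : {perm V}) : grid_aut phi -> grid_aut (phi^-1)%g.
Proof. by move=> H u v; rewrite [RHS]H !permKV. Qed.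

(** An automorphism maps a shortest path to a walk of the same length. *)
Lemma grid_aut_dist_le (phi : {perm V}) u v :
  grid_aut phi -> dist (phi u) (phi v) <= dist u v.
Proof.
move=> H; move Es: (dist u v) => s; elim: s u Es => [|s IH] u.
  rewrite /dist => Es; suff -> : u = v by lia.
  by apply: (@rowcol_inj _ _ _ _ X); lia.
case/dist_step=> w [Huw /IH]; move: Huw; rewrite H => /(adjP X).
by rewrite /dist; lia.
Qed.

Lemma grid_aut_dist (phi : {perm V}) u v :
  grid_aut phi -> dist (phi u) (phi v) = dist u v.
Proof.
move=> H; apply/eqP; rewrite eqn_leq grid_aut_dist_le //=.
by rewrite -{1}(permK phi u) -{1}(permK phi v) grid_aut_dist_le //; apply: grid_aut_inv.
Qed.

Lemma opposite_corners u v : dist u v = (h + h).-1 + (c + c) ->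
  (row u = 0 /\ row v = (h + h).-1 \/ row u = (h + h).-1 /\ row v = 0) /\
  (col u = 0 /\ col v = c + c \/ col u = c + c /\ col v = 0).
Proof.
have := row_lt X v; have := col_le X v; have := row_lt X u; have := col_le X u.
by rewrite /dist; lia.
Qed.

(* Opposite corners realise the diameter; since the sides differ, the images of
   three corners determine the automorphism. *)
Lemma grid_autE (phi : {perm V}) : 0 < h -> grid_aut phi -> exists a b, phi = reflp a b.
Proof.
move=> h0 H; have [M EM] : exists M, M = (h + h).-1 by eexists.
have key u v := grid_aut_dist u v H.
have [hM0 hM] : 0 < h + h /\ M < h + h by lia.
have hc0 := leq0n (c + c); have hcc := leqnn (c + c).
have := opposite_corners (etrans (key (cell 0 0) (cell M (c + c))) _).
have := opposite_corners (etrans (key (cell 0 (c + c)) (cell M 0)) _).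
rewrite {1 2}/dist !row_cell // !col_cell // -EM.
move=> /(_ ltac:(lia)) [] R1 C1 /(_ ltac:(lia)) [] R2 C2.
have K3 := key (cell 0 0) (cell 0 (c + c)).
rewrite /dist !row_cell // !col_cell // in K3.
exists (row (phi (cell 0 0)) != 0), (col (phi (cell 0 0)) != 0).
apply/permP => v; rewrite permE.
have K4 := key v (cell 0 0).
have K5 := key v (cell 0 (c + c)).
rewrite /dist !row_cell // !col_cell // in K4 K5.
have b5 := row_lt X v; have b5' := col_le X v.
have b6 := row_lt X (phi v); have b6' := col_le X (phi v).
(* The two images are corners at distance [c + c], and [M] is odd: they are the two ends of one
   border row. *)
have Rrow : row (phi (cell 0 (c + c))) = row (phi (cell 0 0)) /\
            col (phi (cell 0 (c + c))) + col (phi (cell 0 0)) = c + c.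
  clear K4 K5 b5 b5' b6 b6'.
  by case: R1 => -[r1 r1']; case: R2 => -[r2 r2']; case: C1 => -[c1 c1'];
    case: C2 => -[c2 c2']; rewrite r1 r2 c1 c2 in K3 *; lia.
case: Rrow => Er Ec; clear R1 C1 K3.
(* The distances [K4] and [K5] to these two corners determine row and column through their sum and
   difference. *)
apply: (@rowcol_inj _ _ _ _ X); rewrite ?row_refl ?col_refl -?EM.
  by case: R2 => -[r2 r2']; case: C2 => -[c2 c2']; rewrite r2 c2 in Er Ec *;
    rewrite Er r2 c2 in K4 K5; case: eqP => /= ?; lia.
by case: R2 => -[r2 r2']; case: C2 => -[c2 c2']; rewrite r2 c2 in Er Ec *;
    rewrite Er r2 c2 in K4 K5; case: eqP => /= ?; lia.
Qed.

End Reflections.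

(** * Configurations in terms of robots *)

Section ConfOf.

Variables (m n k : nat).
Implicit Types (p : 'I_k -> node m n).

Lemma conf_of_ge2P p v :
  reflect (exists i j, [/\ i != j, p i = v & p j = v]) (2 <= conf_of p v).
Proof.
rewrite ffunE leq_min leqnn /=; apply: (iffP card_gt1P).
  by case=> i [j []]; rewrite !inE => /eqP ? /eqP ? ?; exists i, j.
by case=> i [j [? Hi Hj]]; exists i, j; rewrite !inE Hi Hj !eqxx.
Qed.

Lemma conf_of_eq0P p v : reflect (forall i, p i <> v) (conf_of p v == 0).
Proof.
rewrite ffunE; apply: (iffP eqP) => [H i Hi|H].
  have : 0 < #|[set i | p i == v]| by apply/card_gt0P; exists i; rewrite inE Hi.
  by lia.
suff -> : [set i | p i == v] = set0 by rewrite cards0 minn0.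
by apply/setP => i; rewrite !inE; apply/eqP.
Qed.

Lemma eq_conf_of p q : p =1 q -> conf_of p = conf_of q.
Proof.
move=> E; apply/ffunP=> v; rewrite !ffunE; congr (minn _ #|pred_of_set _|).
by apply/setP=> i; rewrite !inE E.
Qed.

(** Without multiplicities the cap at 2 loses nothing, so the potential can be read off the
    snapshot. *)
Lemma sum_conf_of p (F : node m n -> nat) : injective p ->
  \sum_v conf_of p v * F v = \sum_i F (p i).
Proof.
move=> inj.
rewrite [RHS](partition_big p predT) //=; apply: eq_bigr => v _.
rewrite (eq_bigr (fun=> F v)) => [|i /eqP -> //]; rewrite sum_nat_const ffunE.
congr (_ * _); suff : #|[set i | p i == v]| <= 1.
  by rewrite cardsE => ?; lia.
rewrite leqNgt; apply/negP => /card_gt1P [i [j []]].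
by rewrite !inE => /eqP <- /eqP /inj -> /eqP.
Qed.

End ConfOf.

(** * The algorithm: orientation test, independence of frames, effect of one step *)

Section Algorithm.

Variables (m n h c : nat) (X : chart m n h c) (f0 : config m n).
Notation V := (node m n).
Notation row := (row X).
Notation col := (col X).
Notation cell := (cell X).
Notation refl := (refl X).

Definition upper v := row v < h.
Definition goal := cell 0 c.
Definition antigoal := cell (h + h).-1 c.

Definition ddiam := h + h + (c + c).
(* The factor 6 forces two upper robots in a configuration of three or more robots
   whose potential is at least balanced. *)
Definition top := 6 * ddiam + 1.
Definition coldist v := (col v - c) + (c - col v).

(** An upper node counts down from [top] by its distance to [goal], a lower one counts up from 0 by
    its distance to [antigoal]; hence the mirror complements the value in [top]. *)
Definition height v :=
  if upper v then top - (row v + coldist v) else (h + h).-1 - row v + coldist v.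

Definition step (f : config m n) v :=
  if upper v then
    if col v < c then cell (row v) (col v).+1
    else if c < col v then cell (row v) (col v).-1
    else if 0 < row v then cell (row v).-1 (col v) else v
  else let w := cell (row v).-1 (col v) in
    if [|| 1 < f goal, upper w | f w == 0] then w else v.

Definition conf_act a b (f : config m n) : config m n := [ffun v => f (refl a b v)].

(** The first test takes precedence because, once [goal] is a multiplicity, unconditional climbing
    may create multiplicities in the lower half. [T'] is the potential of the mirrored
    configuration. The tie-break accepts both left-right variants of [f0], which robots cannot tell
    apart. *)
Definition up (f : config m n) : bool :=
  if (1 < f goal) != (1 < f antigoal) then 1 < f goal
  else if [exists v, 1 < f v] then [forall v, (1 < f v) ==> upper v]
  else let T := \sum_v f v * height v in
       let T' := \sum_v f v * (top - height v) in
       (T' < T) || (T' == T) && [exists b, f == conf_act false b f0].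

Definition gathering : algorithm m n := fun f v =>
  if up f then step f v
  else refl true false (step (conf_act true false f) (refl true false v)).

Hypothesis h_gt0 : 0 < h.
Hypothesis f0_asym : forall b, conf_act true b f0 <> f0.

Lemma row_goal : row goal = 0. Proof. by apply: row_cell; lia. Qed.
Lemma col_goal : col goal = c. Proof. by apply: col_cell; lia. Qed.
Lemma row_antigoal : row antigoal = (h + h).-1. Proof. by apply: row_cell; lia. Qed.
Lemma col_antigoal : col antigoal = c. Proof. by apply: col_cell; lia. Qed.

Lemma refl_goal b : refl false b goal = goal.
Proof.
apply: (@rowcol_inj _ _ _ _ X); rewrite ?row_refl ?col_refl ?col_goal //.
by case: b; lia.
Qed.

Lemma refl_antigoal b : refl false b antigoal = antigoal.
Proof.
apply: (@rowcol_inj _ _ _ _ X); rewrite ?row_refl ?col_refl ?col_antigoal //.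
by case: b; lia.
Qed.

Lemma refl_goalT b : refl true b goal = antigoal.
Proof.
by apply: (@rowcol_inj _ _ _ _ X);
  rewrite ?row_refl ?col_refl ?col_antigoal ?row_antigoal ?row_goal ?col_goal //; case: b; lia.
Qed.

Lemma refl_antigoalT b : refl true b antigoal = goal.
Proof. by rewrite -(refl_goalT b) reflK. Qed.

Lemma upper_refl a b v : upper (refl a b v) = a (+) upper v.
Proof. by rewrite /upper row_refl; have := row_lt X v; case: a => //=; lia. Qed.

Lemma coldist_refl a b v : coldist (refl a b v) = coldist v.
Proof. by rewrite /coldist col_refl; have := col_le X v; case: b => //=; lia. Qed.

Lemma height_refl b v : height (refl false b v) = height v.
Proof. by rewrite /height upper_refl coldist_refl row_refl. Qed.

Lemma height_reflT b v : height (refl true b v) = top - height v.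
Proof.
rewrite /height upper_refl coldist_refl row_refl /= /top /ddiam /upper /coldist.
have := row_lt X v; have := col_le X v => hc hr.
by case: ltnP => /=; lia.
Qed.

Lemma height_le v : height v <= top.
Proof.
rewrite /height  /top /ddiam /upper /coldist.
have := row_lt X v; have := col_le X v => hc hr.
by case: ltnP => /=; lia.
Qed.

Lemma height_low v : ~~ upper v -> height v <= ddiam.
Proof.
move=> /negbTE H; rewrite /height H /ddiam /coldist.
by have := row_lt X v; have := col_le X v; lia.
Qed.

Lemma height_goal : height goal = top.
Proof. by rewrite /height /upper /coldist row_goal col_goal h_gt0; lia. Qed.

Lemma conf_act_comp a b a' b' f :
  conf_act a b (conf_act a' b' f) = conf_act (a (+) a') (b (+) b') f.
Proof. by apply/ffunP=> v; rewrite !ffunE refl_comp addbC [b' (+) _]addbC. Qed.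

Lemma conf_act_id f : conf_act false false f = f.
Proof. by apply/ffunP=> v; rewrite !ffunE refl_id. Qed.

Lemma sum_conf_act a b f (F : V -> nat) :
  \sum_v conf_act a b f v * F v = \sum_v f v * F (refl a b v).
Proof.
rewrite (reindex_inj (inv_inj (reflK X a b))) /=.
by apply: eq_bigr => v _; rewrite ffunE reflK.
Qed.

Lemma exists_mult_conf_act a b f : [exists v, 1 < conf_act a b f v] = [exists v, 1 < f v].
Proof.
apply/existsP/existsP => [[v]|[v Hv]]; first by rewrite ffunE => ?; exists (refl a b v).
by exists (refl a b v); rewrite ffunE reflK.
Qed.

Lemma up_sym b f : up f -> up (conf_act false b f).
Proof.
rewrite /up !ffunE refl_goal refl_antigoal exists_mult_conf_act; case: ifP => // _.
case: ifP => _.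
  move/forallP=> H; apply/forallP=> v; rewrite ffunE; have := H (refl false b v).
  by rewrite upper_refl.
have -> : \sum_v conf_act false b f v * height v = \sum_v f v * height v.
  by rewrite sum_conf_act; apply: eq_bigr => v _; rewrite height_refl.
have -> : \sum_v conf_act false b f v * (top - height v) = \sum_v f v * (top - height v).
  by rewrite sum_conf_act; apply: eq_bigr => v _; rewrite height_refl.
case/orP => [->//|/andP [/eqP -> /existsP [b' /eqP ->]]].
by rewrite eqxx ltnn; apply/existsP; exists (b (+) b'); rewrite conf_act_comp.
Qed.

Lemma up_asym b f : up f -> ~~ up (conf_act true b f).
Proof.
rewrite /up !ffunE refl_goalT refl_antigoalT exists_mult_conf_act [(1 < f antigoal) == _]eq_sym.
case: ifP => [|_]; first by case: (1 < f goal); case: (1 < f antigoal).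
case: ifP => [/existsP [v Hv] /forallP H|_].
  apply/negP => /forallP /(_ (refl true b v)); rewrite ffunE reflK Hv upper_refl.
  by have := H v; rewrite Hv /= => ->.
have -> : \sum_v conf_act true b f v * height v = \sum_v f v * (top - height v).
  by rewrite sum_conf_act; apply: eq_bigr => v _; rewrite height_reflT.
have -> : \sum_v conf_act true b f v * (top - height v) = \sum_v f v * height v.
  by rewrite sum_conf_act; apply: eq_bigr => v _; rewrite height_reflT subKn ?height_le.
(* If [f] and its mirror image were both left-right variants of [f0], then [f0] would have a
   symmetry exchanging the halves. *)
case: ltngtP => //= _ /existsP [b1 /eqP ->]; apply/negP => /existsP [b2 /eqP].
rewrite conf_act_comp /= => /(congr1 (conf_act false b2)); rewrite !conf_act_comp /=.
by rewrite addbb conf_act_id; apply: f0_asym.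
Qed.

Lemma step_sym b f v : step (conf_act false b f) (refl false b v) = refl false b (step f v).
Proof.
have hr := row_lt X v; have hc := col_le X v.
have reflc := refl_cell X false b; rewrite /= in reflc.
rewrite /step upper_refl /= row_refl col_refl; case: ifP => Hu.
  case: b reflc => reflc; last by rewrite !refl_id.
  case: (ltngtP (col v) c) => Hc.
  - have [-> ->] : (c + c - col v < c) = false /\ (c < c + c - col v) by split; lia.
    by rewrite reflc; try lia; congr cell; lia.
  - have -> : c + c - col v < c by lia.
    by rewrite reflc; try lia; congr cell; lia.
  have [-> ->] : (c + c - col v < c) = false /\ (c < c + c - col v) = false by split; lia.
  by case: ifP => Hr //; rewrite reflc; try lia; congr cell; lia.
have Hv: h <= row v by move: Hu; rewrite /upper; lia.
rewrite !ffunE refl_goal -reflc; try lia.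
by rewrite upper_refl reflK /= ; case: ifP.
Qed.

(** By [grid_autE] every frame is a reflection. If it exchanges the halves, [up] fails in it and the
    mirror built into [gathering] undoes the exchange; the left-right mirror commutes with
    [step]. *)
Lemma look_gathering (phi : {perm V}) f v :
  grid_aut phi -> up f -> look gathering phi f v = step f v.
Proof.
move=> /(grid_autE X h_gt0) [a [b ->]] Hf.
have E : relabel (reflp X a b) f = conf_act a b f.
  by apply/ffunP=> w; rewrite !ffunE reflpV permE.
rewrite /look E reflpV !permE /gathering; case: a {E} => /=.
  rewrite (negbTE (up_asym b Hf)) conf_act_comp !refl_comp /=.
  by rewrite ?addbF step_sym reflK.
by rewrite up_sym // step_sym reflK.
Qed.

Lemma step_spec f v : step f v = v \/
  [/\ adj v (step f v), height v < height (step f v), step f v <> antigoal,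
      upper v -> upper (step f v) &
      ~~ upper (step f v) -> row v = (row (step f v)).+1 /\ col v = col (step f v)].
Proof.
have hr := row_lt X v; have hc := col_le X v.
(* Every proper move goes one node up, or sideways towards the middle column within the upper
   half. *)
have : step f v = v \/ exists r l, [/\ step f v = cell r l, r < h + h, l <= c + c &
   (r.+1 = row v /\ l = col v) \/ ((row v < h) /\ r = row v /\
     ((c < col v /\ l.+1 = col v) \/ (col v < c /\ l = (col v).+1)))].
  rewrite /step /upper; case: (ltnP (row v)) => Hu.
    case: (ltnP (col v)) => Hc1; first by right; exists (row v), (col v).+1; split=> //; lia.
    case: (ltnP c) => Hc2; first by right; exists (row v), (col v).-1; split=> //; lia.
    case: (ltnP 0) => Hr; last by left.
    by right; exists (row v).-1, (col v); split=> //; lia.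
  rewrite /=; case: ifP => _; last by left.
  by right; exists (row v).-1, (col v); split=> //; lia.
case=> [->|[r [l [-> hr' hl' H]]]]; [by left|right].
rewrite /height /upper /coldist /top /ddiam row_cell ?col_cell //.
split.
- by apply/(adjP X); rewrite row_cell ?col_cell //; lia.
- by case: (ltnP (row v) h); case: (ltnP r h); lia.
- by move=> /(congr1 row); rewrite row_cell // row_antigoal; lia.
- by lia.
- by lia.
Qed.

Lemma step_upper_fix f v : upper v -> step f v = v -> v = goal.
Proof.
move=> Hu; have hr := row_lt X v; have hc := col_le X v.
rewrite /step Hu; case: ltnP => H1.
  by move/(congr1 col); rewrite col_cell; lia.
case: ltnP => H2; first by move/(congr1 col); rewrite col_cell; lia.
case: ltnP => H3; first by move/(congr1 row); rewrite row_cell; lia.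
by move=> _; apply: (@rowcol_inj _ _ _ _ X); rewrite ?row_goal ?col_goal //; lia.
Qed.

(** The witness is the node just above, which blocks the climb; for a topmost lower robot this is
    contradictory. *)
Lemma step_lower_fix f v : ~~ upper v -> step f v = v ->
  exists w, [/\ ~~ upper w, row w < row v, f w != 0 & f goal <= 1].
Proof.
move=> Hu; have hr := row_lt X v; have hc := col_le X v.
have hv : h <= row v by move: Hu; rewrite /upper; lia.
rewrite /step (negbTE Hu) /=; case: ifP => [_ /(congr1 row)|/norP [G /norP [U Z]] _].
  by rewrite row_cell; lia.
exists (cell (row v).-1 (col v)); split=> //; last by rewrite leqNgt.
by rewrite row_cell; lia.
Qed.

(** Only a climb can end in the lower half, and then its guard did not hold on account of an upper
    target. *)
Lemma step_lower_target f v : ~~ upper (step f v) -> step f v <> v ->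
  1 < f goal \/ f (step f v) == 0.
Proof.
move=> Hl Hne; case: (step_spec f v) => [//|[_ _ _ U _]]; move: Hl Hne.
rewrite /step; case: ifP => [Hu|_ /=].
  by move: (U Hu); rewrite /step Hu => ->.
by case: ifP => // /or3P [|-> //|]; [left|right].
Qed.

Lemma gathering_valid : valid_alg gathering.
Proof.
move=> f v; rewrite /gathering; case: ifP => _.
  by case: (step_spec f v) => [->|[]]; [left|right].
case: (step_spec (conf_act true false f) (refl true false v)) => [->|[H _ _ _ _]].
  by left; rewrite reflK.
by right; have := adj_refl X true false H; rewrite reflK.
Qed.

End Algorithm.

Lemma nondecreasing_stationary (u : nat -> nat) B :
  (forall t, u t <= u t.+1) -> (forall t, u t <= B) ->
  exists T, forall t, T <= t -> u t = u T.
Proof.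
move=> mono bnd.
have monoT : {homo u : a b / a <= b} by apply: homo_leq => //; apply: leq_trans.
(* Induction on the room left below [B]: the value either grows later or is already final. *)
suff H d t0 : B - u t0 <= d -> exists T, forall t, T <= t -> u t = u T by apply: (H B 0); lia.
elim: d t0 => [|d IH] t0 Hd.
  by exists t0 => t /monoT; have := bnd t; have := bnd t0; lia.
case: (classic (exists t, u t0 < u t)) => [[t Ht]|N].
  by apply: (IH t); have := bnd t; lia.
exists t0 => t /monoT Ht; apply/eqP; rewrite eqn_leq Ht andbT leqNgt.
by apply/negP => ?; apply: N; exists t.
Qed.

(** * Invariants of asynchronous executions *)

Section Execution.

Variables (m n h c k : nat) (X : chart m n h c) (p0 : 'I_k -> node m n).
Notation V := (node m n).
Notation row := (row X).
Notation col := (col X).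
Notation cell := (cell X).
Notation refl := (refl X).
Notation upper := (upper X).
Notation height := (height X).
Notation goal := (goal X).
Notation antigoal := (antigoal X).
Notation step := (step X).
Notation f0 := (conf_of p0).

Hypothesis h_gt0 : 0 < h.
Hypothesis f0_asym : forall b, conf_act X true b f0 <> f0.
Hypothesis p0_inj : injective p0.
Hypothesis k_ge3 : 3 <= k.

Definition total_height (p : 'I_k -> V) := \sum_i height (p i).

(** The initial potential is at least balanced; [flip_chart] arranges this if necessary. *)
Hypothesis p0_high : k * top h c <= 2 * total_height p0.

Lemma eq_total p q : p =1 q -> total_height p = total_height q.
Proof. by move=> E; apply: eq_bigr => i _; rewrite E. Qed.

(** The part of [step_spec] that mentions no configuration, so it remains true of a destination
    computed from an outdated snapshot. *)
Definition ascends (v d : V) := [/\ height v < height d, d <> antigoal, upper v -> upper d &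
  ~~ upper d -> row v = (row d).+1 /\ col v = col d].

Definition goal_mult (p : 'I_k -> V) := exists i j, [/\ i != j, p i = goal & p j = goal].

(** Until [goal] is a multiplicity, [inv_low] keeps multiplicities out of the lower half, including
    those that pending moves could create. The strict inequality in [inv_sum] leaves the initial
    positions as the only possible tie. *)
Record inv (s : state m n k) : Prop := Inv {
  inv_pend : forall i d, pend s i = Some d -> d = pos s i \/ ascends (pos s i) d;
  inv_antigoal : forall i j, pos s i = antigoal -> pos s j = antigoal -> i = j;
  inv_low : goal_mult (pos s) \/
    (forall i j, pos s i = pos s j -> ~~ upper (pos s i) -> i = j) /\
    (forall i d j, pend s i = Some d -> d <> pos s i -> ~~ upper d -> pos s j <> d);
  inv_sum : pos s =1 p0 \/ total_height p0 < total_height (pos s);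
  inv_upper : forall i, upper (p0 i) -> upper (pos s i) }.

Lemma inv_up s : inv s -> up X f0 (conf_of (pos s)).
Proof.
case: s => p q [/= _ I2 I3 I4 _]; rewrite /up.
have -> /= : 1 < conf_of p antigoal = false.
  by apply/negP => /conf_of_ge2P [i [j [/eqP nij Hi Hj]]]; apply: nij; apply: I2.
case: (boolP (1 < conf_of p goal)) => //= Ng.
case: I3 => [G|[I3 _]]; first by case/conf_of_ge2P: Ng.
case: ifP => [_|/existsP Nm].
  apply/forallP => v; apply/implyP => /conf_of_ge2P [i [j [/eqP nij Hi Hj]]].
  apply/negPn/negP => Hv; apply: nij; apply: I3; last by rewrite Hi.
  by rewrite Hi.
have inj : injective p.
  move=> i j E; apply/eqP/negPn/negP => nij; apply: Nm; exists (p i).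
  by apply/conf_of_ge2P; exists i, j.
rewrite /= !sum_conf_of //.
(* The two sums compared by [up] add up to [k * top h c], so it suffices to compare one of them with
   half of this. *)
have E : \sum_i (top h c - height (p i)) + \sum_i height (p i) = k * top h c.
  rewrite -big_split /= (eq_bigr (fun=> top h c)) ?sum_nat_const ?card_ord // => i _.
  by rewrite subnK // height_le.
have half a b s K : a + b = K -> K <= 2 * s -> (s < b -> a < b) * (s <= b -> a <= b).
  by move=> *; split; lia.
have [half1 half2] := half _ _ _ _ E p0_high.
case: I4 => [I4|/half1 -> //].
have {}half2 := half2 (eq_leq (esym (eq_total I4))).
have -> : [exists b, conf_of p == conf_act X false b f0].
  by apply/existsP; exists false; rewrite conf_act_id (eq_conf_of I4).
by rewrite andbT orbC -leq_eqVlt.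
Qed.

Lemma total_le p : total_height p <= k * top h c.
Proof.
apply: (@leq_trans (\sum_(i < k) top h c)); first by apply: leq_sum => i _; apply: height_le.
by rewrite sum_nat_const card_ord.
Qed.

Lemma total_upd (p : 'I_k -> V) i d :
  height (p i) < height d -> total_height p < total_height (upd p i d).
Proof.
move=> H; rewrite /total_height (bigD1 i) //= [ltnRHS](bigD1 i) //= {1}/upd eqxx.
rewrite [X in _ < _ + X](eq_bigr (fun j => height (p j))) ?ltn_add2r // => j /negbTE Hj.
by rewrite /upd Hj.
Qed.

Lemma inv_look s i : inv s ->
  inv (St (pos s) (upd (pend s) i (Some (step (conf_of (pos s)) (pos s i))))).
Proof.
case: s => p q [/= I1 I2 I3 I4 I5]; split=> //=.
  move=> j d; rewrite /upd; case: eqP => [->|_]; last exact: I1.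
  move=> [<-]; case: (step_spec X h_gt0 (conf_of p) (p i)) => [->|[]]; first by left.
  by move=> *; right; split.
case: I3 => [|[I3 I3']]; first by left.
case: (classic (goal_mult p)) => [|Ng]; first by left.
right; split=> // j d l; rewrite /upd; case: eqP => [->|_]; last exact: I3'.
move=> [<-] Hs Hu; case: (step_lower_target h_gt0 Hu Hs) => [/conf_of_ge2P //|].
by move/conf_of_eq0P; apply.
Qed.

Lemma inv_move s i d : inv s -> pend s i = Some d ->
  inv (St (upd (pos s) i d) (upd (pend s) i None)).
Proof.
case: s => p q [/= I1 I2 I3 I4 I5] Ed.
have pendN j d' : upd q i None j = Some d' -> j != i /\ q j = Some d'.
  by rewrite /upd; case: eqP.
have updN j x : j != i -> upd p i x j = p j by rewrite /upd => /negbTE ->.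
have updE x : upd p i x i = x by rewrite /upd eqxx.
case: (I1 _ _ Ed) => [E|[A1 A2 A3 A4]].
  have updp : upd p i d =1 p by move=> j; rewrite /upd E; case: eqP => [->|].
  split=> /=.
  - by move=> j d' /pendN [_ /I1]; rewrite updp.
  - by move=> j j'; rewrite !updp; apply: I2.
  - case: I3 => [[a [b G]]|[I3 I3']]; first by left; exists a, b; rewrite !updp.
    right; split=> [a b|a d' b /pendN [_ Ha]]; rewrite !updp; first exact: I3.
    exact: I3'.
  - case: I4 => [I4|I4]; first by left=> j; rewrite updp.
    by right; rewrite (eq_total updp).
  - by move=> j; rewrite updp; apply: I5.
split=> /=.
- by move=> j d' /pendN [ji /I1]; rewrite updN.
- move=> j j'; case: (eqVneq j i) => [->|ji]; first by rewrite updE.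
  case: (eqVneq j' i) => [->|ji']; first by rewrite updE.
  by rewrite !updN //; apply: I2.
- case: I3 => [[a [b [ab Ha Hb]]]|[I3 I3']].
    (* [goal] has maximal height, so the moving robot does not start there and the multiplicity
       persists. *)
    left; exists a, b; have gi x : p x = goal -> x != i.
      move=> Hx; apply/eqP => E; have := height_le X h_gt0 d.
      by move: A1; rewrite -E Hx height_goal //; lia.
    by rewrite !updN ?gi.
  have dp : d <> p i by move=> E; rewrite E ltnn in A1.
  right; split=> [a b|a d' b /pendN [ai Ha]].
    case: (eqVneq a i) => [->|ai]; case: (eqVneq b i) => [->|bi] //; rewrite ?updE ?updN //.
    + by move=> E Hd; case: (I3' i d b Ed).
    + by move=> E Hd; case: (I3' i d a Ed) => //; rewrite -E.
    + exact: I3.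
  rewrite updN // => Hd Hu; case: (eqVneq b i) => [->|bi]; last first.
    by rewrite updN //; apply: I3' Ha _ _.
  rewrite updE => E; subst d'.
  (* Both robots enter the same lower node from the node below it, so they already shared a lower
     node, which [I3] excludes. *)
  case: (I1 _ _ Ha) => [//|[_ _ C3 C4]].
  case: (C4 Hu) => r1 c1; case: (A4 Hu) => r2 c2.
  have Epp : p a = p i by apply: (@rowcol_inj _ _ _ _ X); congruence.
  case/eqP: ai; apply: I3 => //.
  by apply/negP => /C3; apply/negP.
- right; have L := total_upd A1.
  by case: I4 => [/eq_total <-|I4]; [exact: L|exact: ltn_trans I4 L].
- move=> j; case: (eqVneq j i) => [->|ji]; last by rewrite updN //; apply: I5.
  by rewrite updE => /I5.
Qed.

(** * Convergence of a run *)

Section Run.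

Variables (act : nat -> 'I_k) (phis : nat -> {perm V}).
Hypothesis phisP : forall t, grid_aut (phis t).
Notation run := (exec (gathering X f0) p0 act phis).

Lemma inv_run t : inv (run t).
Proof.
elim: t => [|t IH] /=.
  split=> //=; last by left.
    by move=> i j <- /p0_inj.
  by right; split=> // i j /p0_inj.
case E: (pend _ _) => [d|]; first exact: inv_move.
by rewrite look_gathering //; [apply: inv_look|apply: inv_up].
Qed.

(** The equality case turns a constant potential into constant positions. *)
Lemma run_mono t :
  total_height (pos (run t)) <= total_height (pos (run t.+1)) ?=
     iff [forall i, pos (run t.+1) i == pos (run t) i].
Proof.
have := inv_run t; rewrite /=; case E: (pend _ _) => [d|] I /=; last first.
  by apply/leqifP; case: forallP => // -[].
case: (inv_pend I E) => [->|[Hh _ _ _]].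
  have Eu : upd (pos (run t)) (act t) (pos (run t) (act t)) =1 pos (run t).
    by move=> i; rewrite /upd; case: eqP => [->|].
  by apply/leqifP; case: forallP => [_|[] i]; [apply/eqP/esym/eq_total|rewrite Eu].
apply/leqifP; case: forallP => [/(_ (act t))|_]; last exact: total_upd.
by rewrite /upd eqxx => /eqP Ed; rewrite Ed ltnn in Hh.
Qed.

Lemma run_stationary : exists T, forall t, T <= t -> pos (run t) =1 pos (run T).
Proof.
have [T HT] : exists T, forall t, T <= t ->
    total_height (pos (run t)) = total_height (pos (run T)).
  apply: (@nondecreasing_stationary _ (k * top h c)) => t; first exact: run_mono.
  exact: total_le.
exists T; elim=> [|t IH]; first by rewrite leqn0 => /eqP ->.
rewrite leq_eqVlt => /predU1P [<- //|Ht] i.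
rewrite -IH //; have [_] := run_mono t; rewrite (HT t) // (HT t.+1) ?eqxx; last by lia.
by move=> /esym /forallP /(_ i) /eqP.
Qed.

(** Otherwise three activations after [T] lead to a contradiction: the first gets rid of any
    outdated destination, the second leaves [d] pending, the third moves the robot. *)
Lemma stationary_step T i :
  (forall t, T <= t -> pos (run t) =1 pos (run T)) ->
  (forall t, exists t', t <= t' /\ act t' = i) ->
  step (conf_of (pos (run T))) (pos (run T) i) = pos (run T) i.
Proof.
move=> HT fairi; set d := step _ _; apply/eqP/negPn/negP => /eqP Hd.
have next t : T <= t -> act t = i ->
    pend (run t.+1) i = if pend (run t) i is Some _ then None else Some d.
  move=> Ht Ei /=; rewrite Ei; case: (pend (run t) i) => [d'|] /=; first by rewrite /upd eqxx.
  rewrite /upd eqxx look_gathering // ?(eq_conf_of (HT t Ht)) ?HT //.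
  exact/inv_up/inv_run.
have keep t : act t <> i -> pend (run t.+1) i = pend (run t) i.
  by move=> /eqP /negbTE Ei /=; case: (pend _ (act t)) => [?|] /=; rewrite /upd eq_sym Ei.
have nomove t : T <= t -> act t = i -> pend (run t) i <> Some d.
  move=> Ht Ei E; apply: Hd; have := HT t.+1 (leqW Ht) i.
  by rewrite /= Ei E /= /upd eqxx.
have [t1 [Ht1 E1]] := fairi T.
have pend1 t : t1 < t -> pend (run t) i = None \/ pend (run t) i = Some d.
  elim: t => // t IH; rewrite ltnS leq_eqVlt => /predU1P [<-|Ht].
    by rewrite next //; case: (pend _ i); [left|right].
  case: (eqVneq (act t) i) => [E|/eqP E]; last by rewrite keep //; apply: IH.
  by rewrite next //; [case: (pend _ i); [left|right]|lia].
have [t2 [Ht2 E2]] := fairi t1.+1.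
have E2' : pend (run t2.+1) i = Some d.
  by rewrite next //; [case: (pend1 t2) => // [-> //|/nomove []//]; lia|lia].
have pend2 t : t2 < t -> pend (run t) i = Some d.
  elim: t => // t IH; rewrite ltnS leq_eqVlt => /predU1P [<- //|Ht].
  case: (eqVneq (act t) i) => [E|/eqP E]; last by rewrite keep //; apply: IH.
  by case: (nomove t) => //; [lia|apply: IH].
have [t3 [Ht3 E3]] := fairi t2.+1.
by case: (nomove t3) => //; [lia|apply: pend2].
Qed.

End Run.

Lemma two_upper : exists i j, [/\ i != j, upper (p0 i) & upper (p0 j)].
Proof.
suff : 1 < #|[set i | upper (p0 i)]|.
  by case/card_gt1P => i [j [] ]; rewrite !inE => *; exists i, j.
rewrite ltnNge; apply/negP => H.
have : total_height p0 <= \sum_(i < k) (ddiam h c + (if upper (p0 i) then top h c else 0)).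
  apply: leq_sum => i _; case: ifP => Hu; first by have := height_le X h_gt0 (p0 i); lia.
  by have := height_low h_gt0 (negbT Hu); lia.
rewrite big_split /= sum_nat_const card_ord -big_mkcond sum_nat_const.
rewrite -cardsE; move: p0_high H; rewrite /top; set D := ddiam h c.
(* With [a <= 1] this would give [k * (6 * D + 1) <= 2 * (k * D + (6 * D + 1))], which fails for
   [3 <= k]. *)
move: #|_| (total_height p0) => a S ? ? ?; nia.
Qed.

Lemma chart_gatherable : gatherable_1crash p0.
Proof.
exists (gathering X f0); split; first exact: gathering_valid.
move=> act phis crash phisP _ fairP.
have [T HT] := run_stationary act phisP.
set p := pos (exec (gathering X f0) p0 act phis T) in HT.
have fixp i : ~ faulty crash i -> step (conf_of p) (p i) = p i.
  by move=> Hi; apply: stationary_step => //; apply: fairP.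
have faulty1 i j : faulty crash i -> faulty crash j -> i = j.
  by case=> t ->; case=> t' [].
have I := inv_run act phisP T.
have G : goal_mult p.
  apply: NNPP => NG; have [i [j [ij Ui Uj]]] := two_upper.
  have atgoal x y : x != y -> p x = goal -> p y = goal -> False.
    by move=> *; apply: NG; exists x, y.
  have upg x : ~ faulty crash x -> upper (p x) -> p x = goal.
    by move=> /fixp E U; exact: (step_upper_fix h_gt0 U E).
  (* At most one of the two is faulty; if neither were, both would stand on [goal]. *)
  wlog Fj : i j ij Ui Uj / faulty crash j.
    move=> W; case: (classic (faulty crash j)) => [|Nj]; first exact: (W i j).
    case: (classic (faulty crash i)) => [|Ni]; first by apply: (W j i); rewrite // eq_sym.
    by apply: (atgoal i j) => //; apply: upg => //; apply: (inv_upper I).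
  have NF x : x != j -> ~ faulty crash x by move=> /eqP xj Fx; apply: xj; apply: faulty1.
  have pig : p i = goal by apply: upg; [apply: NF|apply: (inv_upper I)].
  (* Robot [i] occupies [goal], and a further non-faulty upper robot would join it there. *)
  have Low x : x != i -> x != j -> ~~ upper (p x).
    move=> xi xj; apply/negP => U; apply: (atgoal x i) => //; apply: upg => //; exact: NF.
  have [l /andP [li lj]] : exists l, (l != i) && (l != j).
    have : 0 < #|~: [set i; j]|.
      by have := cardsC [set i; j]; rewrite cards2 card_ord; case: (_ != _) => /=; lia.
    by case/card_gt0P => l; rewrite !inE negb_or; exists l.
  (* Rows grow downwards, so [x] is a topmost lower robot; whatever blocks it would be a lower robot
     above it. *)
  case: (@arg_minnP _ l (fun x => ~~ upper (p x)) (fun x => row (p x)) (Low l li lj)) => x Ux xmin.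
  have xj : x != j by apply/eqP => E; case/negP: Ux; rewrite E; apply: (inv_upper I).
  have [w [Uw rw /conf_of_eq0P fw _]] := step_lower_fix h_gt0 Ux (fixp _ (NF _ xj)).
  apply: fw => y Ey; have := xmin y; rewrite Ey => /(_ Uw); lia.
exists T, goal => t Ht i Hi; rewrite HT // -/p.
(* A multiplicity on [goal] unblocks every lower robot, so the stationary non-faulty ones are upper
   and have arrived. *)
case: (boolP (upper (p i))) => U; first exact: (step_upper_fix h_gt0 U (fixp i Hi)).
have [w [_ _ _ Hg]] := step_lower_fix h_gt0 U (fixp i Hi).
by have /conf_of_ge2P := G; rewrite ltnNge Hg.
Qed.

End Execution.

(** * Choice of the chart and conclusion *)

Section Flip.

Variables (m n h c : nat) (X : chart m n h c).

Lemma flip_chart_subproof (Y := fun a b => cell X ((h + h).-1 - a) b)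
    (r := fun v => (h + h).-1 - row X v) :
  [/\ forall v, r v < h + h, forall a b, a < h + h -> b <= c + c -> r (Y a b) = a,
      forall a b, a < h + h -> b <= c + c -> col X (Y a b) = b,
      forall u v, r u = r v -> col X u = col X v -> u = v &
      forall u v, adj u v <->
        (r u = r v /\ ((col X u).+1 = col X v \/ (col X v).+1 = col X u)) \/
        (col X u = col X v /\ ((r u).+1 = r v \/ (r v).+1 = r u))].
Proof.
split; rewrite /r /Y.
- by move=> v; have := row_lt X v; lia.
- by move=> a b *; rewrite row_cell; lia.
- by move=> a b *; rewrite col_cell; lia.
- move=> u v; have := row_lt X u; have := row_lt X v => ? ? ? ?.
  by apply: (@rowcol_inj _ _ _ _ X) => //; lia.
- move=> u v; have := row_lt X u; have := row_lt X v => ? ?.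
  by rewrite (adjP X); lia.
Qed.

(** The same grid with the halves interchanged; this complements the potential, so one of the two
    charts is at least balanced. *)
Definition flip_chart : chart m n h c :=
  let: And5 H1 H2 H3 H4 H5 := flip_chart_subproof in Chart H1 (col_le X) H2 H3 H4 H5.

Lemma row_flip v : row flip_chart v = (h + h).-1 - row X v.
Proof. by rewrite /flip_chart; case: flip_chart_subproof. Qed.

Lemma col_flip v : col flip_chart v = col X v.
Proof. by rewrite /flip_chart; case: flip_chart_subproof. Qed.

Lemma height_flip v : height flip_chart v = top h c - height X v.
Proof.
rewrite /height /coldist /upper row_flip !col_flip /top /ddiam.
have := row_lt X v; have := col_le X v => hc hr.
by case: (ltnP (row X v) h) => H; case: (ltnP ((h + h).-1 - row X v) h) => H'; lia.
Qed.

End Flip.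

(** The number of rows is even, so no row is its own mirror image and every orbit of the reflection
    has size 2. *)
Lemma refl_partitive m n h c (X : chart m n h c) (f : config m n) b :
  0 < h -> conf_act X true b f = f -> partitive f.
Proof.
move=> h_gt0 E; exists (reflp X true b).
have nfix v : refl X true b v != v.
  apply/eqP => /(congr1 (row X)); rewrite row_refl; have := row_lt X v; lia.
split; first split; first exact: grid_aut_reflp.
  by move=> v; rewrite permE -{2}E ffunE.
have ord2 v : fingraph.order (reflp X true b) v = 2.
  rewrite (@order_cycle _ _ [:: v; refl X true b v]) //= ?inE ?eqxx //.
    by rewrite !permE reflK !eqxx.
  by rewrite eq_sym nfix.
suff -> : #[reflp X true b]%g = 2 by [].
apply: nt_prime_order => //.
  by apply/permP => v; rewrite expgS expg1 permM !permE reflK.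
apply/eqP => /permP /(_ (cell X 0 0)); rewrite permE perm1 => /eqP.
exact/negP.
Qed.

Lemma even_odd_gatherable m n h c k (X : chart m n h c) (p0 : 'I_k -> node m n) :
  0 < h -> 3 <= k -> injective p0 -> ~ partitive (conf_of p0) -> gatherable_1crash p0.
Proof.
move=> h_gt0 k_ge3 p0_inj Npart.
have asym (Y : chart m n h c) b : conf_act Y true b (conf_of p0) <> conf_of p0.
  by move/(refl_partitive h_gt0).
case: (leqP (k * top h c) (2 * total_height X p0)) => [|/ltnW] H.
  exact: (@chart_gatherable _ _ _ _ _ X).
apply: (@chart_gatherable _ _ _ _ _ (flip_chart X)) => //.
have : total_height (flip_chart X) p0 + total_height X p0 = k * top h c.
  rewrite /total_height -big_split /= (eq_bigr (fun=> top h c)) ?sum_nat_const ?card_ord // => i _.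
  by rewrite height_flip subnK // height_le.
lia.
Qed.

Lemma adj_coords m n (u v : node m n) : adj u v <->
  (val u.1 = val v.1 /\ ((val u.2).+1 = val v.2 \/ (val v.2).+1 = val u.2)) \/
  (val u.2 = val v.2 /\ ((val u.1).+1 = val v.1 \/ (val v.1).+1 = val u.1)).
Proof.
split; first by case/orP => /andP [/eqP-> /orP [] /eqP ->]; intuition.
by rewrite /adj; case=> -[-> [] ->]; rewrite !eqxx ?orbT.
Qed.

(** [v0] supplies the default for coordinates out of bounds. *)
Definition node_cell m n (v0 : node m n) a b : node m n := (insubd v0.1 a, insubd v0.2 b).

Lemma node_cell1 m n (v0 : node m n) a b : a < m -> val (node_cell v0 a b).1 = a.
Proof. by move=> H; rewrite val_insubd H. Qed.

Lemma node_cell2 m n (v0 : node m n) a b : b < n -> val (node_cell v0 a b).2 = b.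
Proof. by move=> H; rewrite val_insubd H. Qed.

Lemma row_even_chart h c (v0 : node (h + h) (c + c).+1) : chart (h + h) (c + c).+1 h c.
Proof.
apply: (@Chart _ _ _ _ (fun v => val v.1) (fun v => val v.2) (node_cell v0))
  => [v|v|a b ? ?|a b ? ?|[a b] [a' b'] /= /val_inj -> /val_inj -> //|].
- exact: ltn_ord.
- by rewrite -ltnS; apply: ltn_ord.
- exact: node_cell1.
- exact: node_cell2.
- exact: adj_coords.
Qed.

Lemma col_even_chart h c (v0 : node (c + c).+1 (h + h)) : chart (c + c).+1 (h + h) h c.
Proof.
apply: (@Chart _ _ _ _ (fun v => val v.2) (fun v => val v.1) (fun a b => node_cell v0 b a))
  => [v|v|a b ? ?|a b ? ?|[a b] [a' b'] /= /val_inj -> /val_inj -> //|u v].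
- exact: ltn_ord.
- by rewrite -ltnS; apply: ltn_ord.
- exact: node_cell2.
- exact: node_cell1.
- by rewrite adj_coords; tauto.
Qed.

Theorem theorem3 (m n k : nat) (p0 : 'I_k -> node m n) :
  odd m != odd n -> 3 <= k -> injective p0 -> ~ partitive (conf_of p0) ->
  gatherable_1crash p0.
Proof.
move=> par k_ge3 inj Npart.
(* A robot exists, so the grid has a node and both sides are positive; hence so is half of the even
   one. *)
have v0 : node m n by case: k k_ge3 p0 {inj Npart} => // k _ p0; apply: (p0 ord0).
have m_gt0 : 0 < m by case: m v0 {p0 par inj Npart} => // -[[]].
have n_gt0 : 0 < n by case: n v0 {p0 par inj Npart} => // -[? []].
have Em := odd_double_half m; have En := odd_double_half n.
rewrite -!addnn in Em En.
(* The parities decide which coordinate plays the role of [row]. *)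
case Om: (odd m) par Em; case On: (odd n) En => //= En _ Em.
- move: m_gt0 n_gt0 p0 v0 inj Npart; rewrite -Em -En => _ n_gt0 p0 v0 inj Npart.
  by apply: (even_odd_gatherable (col_even_chart v0)) => //; lia.
- move: m_gt0 n_gt0 p0 v0 inj Npart; rewrite -Em -En => m_gt0 _ p0 v0 inj Npart.
  by apply: (even_odd_gatherable (row_even_chart v0)) => //; lia.
Qed.
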